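(* Let $\mathbb H=(A,\prec,\mathcal C)$ be a defined proto sp-algebra with $A$ a bounded lattice, and let $\overline{\mathcal C}=(A\times A)\setminus\mathcal C$. Let $\rhd a=\bigvee\{b\in A\mid a\,\overline{\mathcal C}\,b\}$ in $A^\delta$. For $1\le i\le4$ let $\prec_i$, $\overline{\mathcal C}_i$ be the closures of $\prec$, $\overline{\mathcal C}$ defined in the context, and let $\Diamond_ia=\bigwedge\{b\in A\mid a\prec_ib\}$ and $\rhd_ia=\bigvee\{b\in A\mid a\,\overline{\mathcal C}_i\,b\}$ in $A^\delta$. Among maps $g:A\to A^\delta$ with $g(a)\in O(A^\delta)$ for all $a\in A$, ordered pointwise: 1. $\rhd_1$ is the smallest antitone map dominating $\rhd$. 2. $\rhd_2$ is the smallest regular map dominating $\rhd$. 3. $\rhd_3$ is the smallest antitone map $g$ dominating $\rhd$ which satisfies $g(a\wedge\Diamond_3a)\le g(a)$ for all $a\in A$. 4. $\rhd_4$ is the smallest regular map $g$ dominating $\rhd$ which satisfies $g(a\wedge\Diamond_4a)\le g(a)$ for all $a\in A$. (In each item it is part of the claim that $\rhd_i$ itself is a map of the stated kind.)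
   Context: Canonical extension. For a poset $A$, $A^\delta$ is a complete lattice containing $A$ as a subposet. $k\in A^\delta$ is closed ($k\in K(A^\delta)$) if $k=\bigwedge F$ for some nonempty down-directed $F\subseteq A$; $o$ is open ($o\in O(A^\delta)$) if $o=\bigvee I$ for some nonempty up-directed $I\subseteq A$. Denseness: every element of $A^\delta$ is a join of closed elements and a meet of open elements. Compactness: if $F\subseteq A$ is nonempty down-directed, $I\subseteq A$ nonempty up-directed and $\bigwedge F\le\bigvee I$, then $a\le b$ for some $a\in F$, $b\in I$. $A^\delta$ exists and is unique up to isomorphism fixing $A$. A proto sp-algebra is $(A,\prec,\mathcal C)$ with $\prec,\mathcal C\subseteq A\times A$. It is defined if for $\prec$: $\forall a\exists b(b\prec a)$; $\forall a\exists b(a\prec b)$; $a\prec x_1\ \&\ a\prec x_2\Rightarrow\exists x(a\prec x\ \&\ x\le x_1\ \&\ x\le x_2)$; $a_1\prec x\ \&\ a_2\prec x\Rightarrow\exists a(a\prec x\ \&\ a_1\le a\ \&\ a_2\le a)$; and for $\overline{\mathcal C}$: $\forall a\exists b(b\,\overline{\mathcal C}\,a)$; $\forall a\exists b(a\,\overline{\mathcal C}\,b)$; $a\,\overline{\mathcal C}\,x_1\ \&\ a\,\overline{\mathcal C}\,x_2\Rightarrow\exists x(x_1\le x\ \&\ x_2\le x\ \&\ a\,\overline{\mathcal C}\,x)$; $a_1\,\overline{\mathcal C}\,x\ \&\ a_2\,\overline{\mathcal C}\,x\Rightarrow\exists a(a_1\le a\ \&\ a_2\le a\ \&\ a\,\overline{\mathcal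 C}\,x)$. $\prec_i$ is the smallest extension of $\prec$ satisfying: ($\top$) $\top\prec\top$, (SI) $a\le b\prec x\Rightarrow a\prec x$, (WO) $b\prec x\le y\Rightarrow b\prec y$, (AND) $a\prec x\ \&\ a\prec y\Rightarrow a\prec x\wedge y$; together with, for $i\in\{2,4\}$, (OR) $a\prec x\ \&\ b\prec x\Rightarrow a\vee b\prec x$; and, for $i\in\{3,4\}$, (CT) $a\prec b\ \&\ a\wedge b\prec c\Rightarrow a\prec c$. $\overline{\mathcal C}_i$ is the smallest extension $N$ of $\overline{\mathcal C}$ satisfying: $\top\,N\,\bot$; $b\,N\,c\ \&\ a\le b\Rightarrow a\,N\,c$; $a\,N\,c\ \&\ b\le c\Rightarrow a\,N\,b$; $a\,N\,b\ \&\ a\,N\,c\Rightarrow a\,N\,(b\vee c)$; together with, for $i\in\{2,4\}$, $a\,N\,c\ \&\ b\,N\,c\Rightarrow(a\vee b)\,N\,c$; and, for $i\in\{3,4\}$, $a\prec_ib\ \&\ (a\wedge b)\,N\,c\Rightarrow a\,N\,c$. $g$ dominates $\rhd$ if $\rhd a\le g(a)$ for all $a\in A$; $g$ is antitone if $a\le b$ implies $g(b)\le g(a)$; regular if $g(a\vee b)=g(a)\wedge g(b)$ for all $a,b\in A$. In $g(a\wedge\Diamond_ia)$, $g$ is evaluated at the closed element $a\wedge\Diamond_ia$ by $g(k):=\bigvee\{g(c)\mid c\in A,k\le c\}$. *)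

(* Defs.v *)
From HB Require Import structures.
From mathcomp Require Import all_boot all_order.
From mathcomp Require Import boolp classical_sets.

Set Implicit Arguments.
Unset Strict Implicit.
Unset Printing Implicit Defensive.

Import Order.Theory.

Local Open Scope classical_set_scope.
Local Open Scope order_scope.

(* Binary relations on A are subsets of A * A: a R b is written R (a, b). *)

Definition down_directed d (A : porderType d) (F : set A) : Prop :=
  F !=set0 /\
  forall x y, F x -> F y -> exists z, [/\ F z, z <= x & z <= y].

Definition up_directed d (A : porderType d) (I : set A) : Prop :=
  I !=set0 /\
  forall x y, I x -> I y -> exists z, [/\ I z, x <= z & y <= z].

Definition complete_lattice d (L : tbLatticeType d) : Prop :=
  forall S : set L, supremums S !=set0 /\ infimums S !=set0.

(* The default values \bot and \top are the values at the empty set. *)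
Definition bigsup d (L : tbLatticeType d) (S : set L) : L := supremum \bot S.
Definition biginf d (L : tbLatticeType d) (S : set L) : L := infimum \top S.

Section CanonicalExtension.
Context {d d' : Order.disp_t} {A : porderType d} {L : tbLatticeType d'}.
Variable e : A -> L.

Definition closed_elt (k : L) : Prop :=
  exists2 F : set A, down_directed F & k = biginf [set e a | a in F].

Definition open_elt (o : L) : Prop :=
  exists2 I : set A, up_directed I & o = bigsup [set e a | a in I].

Definition denseness : Prop := forall u : L,
  (exists2 S : set L, (forall k, S k -> closed_elt k) & u = bigsup S) /\
  (exists2 S : set L, (forall o, S o -> open_elt o) & u = biginf S).

Definition compactness : Prop := forall F I : set A,
  down_directed F -> up_directed I ->
  biginf [set e a | a in F] <= bigsup [set e b | b in I] ->
  exists a b, [/\ F a, I b & a <= b].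

(* L, with A embedded in it by e, is the canonical extension of the poset A
   (which is determined up to an isomorphism fixing A). *)
Definition canonical_extension : Prop :=
  [/\ complete_lattice L, {mono e : a b / a <= b}, denseness & compactness].

Definition Diamond (R : set (A * A)) (a : A) : L :=
  biginf [set e b | b in [set b | R (a, b)]].

Definition rhd (R : set (A * A)) (a : A) : L :=
  bigsup [set e b | b in [set b | R (a, b)]].

Definition ext_closed (g : A -> L) (k : L) : L :=
  bigsup [set g c | c in [set c | k <= e c]].

Definition dominates (g f : A -> L) : Prop := forall a, f a <= g a.

(* f is the smallest, in the pointwise order, among the maps with open values
   that satisfy P; in particular f is itself such a map. *)
Definition smallest_map (P : (A -> L) -> Prop) (f : A -> L) : Prop :=
  [/\ forall a, open_elt (f a), P f &
      forall g : A -> L,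
        (forall a, open_elt (g a)) -> P g -> forall a, f a <= g a].

Definition antitone (g : A -> L) : Prop := forall a b, a <= b -> g b <= g a.

End CanonicalExtension.

Definition regular d d' (A : latticeType d) (L : latticeType d')
    (g : A -> L) : Prop :=
  forall a b, g (a `|` b) = g a `&` g b.

Section ProtoSpAlgebra.
Context {d : Order.disp_t} {A : porderType d}.

Definition defined_prec (R : set (A * A)) : Prop :=
  [/\ forall a, exists b, R (b, a),
      forall a, exists b, R (a, b),
      forall a x1 x2, R (a, x1) -> R (a, x2) ->
        exists x, [/\ R (a, x), x <= x1 & x <= x2] &
      forall a1 a2 x, R (a1, x) -> R (a2, x) ->
        exists a, [/\ R (a, x), a1 <= a & a2 <= a]].

Definition defined_noncontact (N : set (A * A)) : Prop :=
  [/\ forall a, exists b, N (b, a),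
      forall a, exists b, N (a, b),
      forall a x1 x2, N (a, x1) -> N (a, x2) ->
        exists x, [/\ x1 <= x, x2 <= x & N (a, x)] &
      forall a1 a2 x, N (a1, x) -> N (a2, x) ->
        exists a, [/\ a1 <= a, a2 <= a & N (a, x)]].

Definition defined_proto_sp_algebra (prec contact : set (A * A)) : Prop :=
  defined_prec prec /\ defined_noncontact (~` contact)%classic.

End ProtoSpAlgebra.

Section Closures.
Context {d : Order.disp_t} {A : tbLatticeType d}.

Definition prec_rules (i : nat) (R : set (A * A)) : Prop :=
  [/\ R (\top, \top),
      forall a b x, a <= b -> R (b, x) -> R (a, x),
      forall b x y, R (b, x) -> x <= y -> R (b, y) &
      forall a x y, R (a, x) -> R (a, y) -> R (a, x `&` y)] /\
  (i \in [:: 2; 4]%N ->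
    forall a b x, R (a, x) -> R (b, x) -> R (a `|` b, x)) /\
  (i \in [:: 3; 4]%N ->
    forall a b c, R (a, b) -> R (a `&` b, c) -> R (a, c)).

Definition prec_closure (i : nat) (prec : set (A * A)) : set (A * A) :=
  smallest (prec_rules i) prec.

Definition noncontact_rules (i : nat) (prec_i N : set (A * A)) : Prop :=
  [/\ N (\top, \bot),
      forall a b c, N (b, c) -> a <= b -> N (a, c),
      forall a b c, N (a, c) -> b <= c -> N (a, b) &
      forall a b c, N (a, b) -> N (a, c) -> N (a, b `|` c)] /\
  (i \in [:: 2; 4]%N ->
    forall a b c, N (a, c) -> N (b, c) -> N (a `|` b, c)) /\
  (i \in [:: 3; 4]%N ->
    forall a b c, prec_i (a, b) -> N (a `&` b, c) -> N (a, c)).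

Definition noncontact_closure (i : nat) (prec contact : set (A * A)) :
    set (A * A) :=
  smallest (noncontact_rules i (prec_closure i prec)) (~` contact)%classic.

End Closures.

(* Main.v *)
Require Import Defs.
From mathcomp Require Import all_boot all_order.
From mathcomp Require Import boolp classical_sets.
Set Implicit Arguments.
Unset Strict Implicit.
Unset Printing Implicit Defensive.

Import Order.Theory.
Local Open Scope classical_set_scope.
Local Open Scope order_scope.

(** A map [g] with open values is encoded by the relation
    [N_g = {(a, b) | b <= g a}]: [g] dominates [rhd e N] exactly when [N] is
    contained in [N_g].  Each property required of [g] makes [N_g] satisfy the
    corresponding rules (closure under joins in the second argument comes from
    compactness, as [g a] is a directed join), so the smallest relation
    satisfying them is contained in [N_g]; this is minimality.  In the other
    direction, the sets [{b | N (a, b)}] and [{a `&` b | a prec_i b}] are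
    directed, so compactness turns the rules for [N] into the required
    properties of [rhd e N]. *)

(** * Arbitrary joins and meets in a complete lattice *)

Section CompleteLattice.
Context {d : Order.disp_t} {L : tbLatticeType d}.
Hypothesis Lc : complete_lattice L.
Implicit Types (S : set L) (x : L).

Lemma bigsup_ub S x : S x -> x <= bigsup S.
Proof.
rewrite /bigsup /supremum; case: eqP => [-> //|_].
by have [/(xgetPex \bot)[+ _] _] := Lc S; apply.
Qed.

Lemma biginf_lb S x : S x -> biginf S <= x.
Proof.
rewrite /biginf /infimum; case: eqP => [-> //|_].
by have [_ /(xgetPex \top)[+ _]] := Lc S; apply.
Qed.

Lemma bigsup_le S x : ubound S x -> bigsup S <= x.
Proof.
(* On the empty set the default value [\bot] is the true supremum. *)
rewrite /bigsup /supremum; case: eqP => _ Sx; first exact: le0x.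
by have [/(xgetPex \bot)[_ +] _] := Lc S; apply.
Qed.

Lemma biginf_ge S x : lbound S x -> x <= biginf S.
Proof.
rewrite /biginf /infimum; case: eqP => _ Sx; first exact: lex1.
by have [_ /(xgetPex \top)[_ +]] := Lc S; apply.
Qed.

End CompleteLattice.

Lemma down_directed1 {d} {A : porderType d} (a : A) : down_directed [set a].
Proof. by split=> [|x y -> ->]; exists a. Qed.

Lemma up_directed1 {d} {A : porderType d} (a : A) : up_directed [set a].
Proof. by split=> [|x y -> ->]; exists a. Qed.

(** * Consequences of compactness and denseness *)

Section CanonicalExtension.
Context {d d' : Order.disp_t} {A : tbLatticeType d} {L : tbLatticeType d'}.
Context {e : A -> L}.
Hypothesis eP : canonical_extension e.
Implicit Types (F I : set A) (a b c : A) (u v k o : L).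

Let Lc : complete_lattice L. Proof. by case: eP. Qed.
Let e_mono : {mono e : a b / a <= b}. Proof. by case: eP. Qed.

Lemma directed_inf_le F a : down_directed F ->
  biginf [set e f | f in F] <= e a -> exists2 f, F f & f <= a.
Proof.
move=> Fd Fa; have [_ _ _ cmp] := eP.
have [|f [_ [Ff -> fa]]] := cmp F [set a] Fd (up_directed1 a); last by exists f.
by apply: (le_trans Fa); apply: (bigsup_ub Lc); exists a.
Qed.

Lemma le_directed_sup I a : up_directed I ->
  e a <= bigsup [set e i | i in I] -> exists2 i, I i & a <= i.
Proof.
move=> Id aI; have [_ _ _ cmp] := eP.
have [|_ [i [-> Ii ai]]] := cmp [set a] I (down_directed1 a) Id; last by exists i.
by apply: le_trans aI; apply: (biginf_lb Lc); exists a.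
Qed.

(** Compactness yields [f <= i] with [f] in the family defining [k], and [k] lies below [e f]. *)
Lemma closed_le_directed_sup I k : up_directed I -> closed_elt e k ->
  k <= bigsup [set e i | i in I] -> exists2 i, I i & k <= e i.
Proof.
move=> Id [F Fd ->] FI; have [_ _ _ cmp] := eP.
have [f [i [Ff Ii fi]]] := cmp F I Fd Id FI; exists i => //.
by apply: (@le_trans _ _ (e f)); [apply: (biginf_lb Lc); exists f|rewrite e_mono].
Qed.

(** By denseness [u] is a join of closed elements, so inequalities can be tested on these, where
    compactness applies. *)
Lemma le_closed u v : (forall k, closed_elt e k -> k <= u -> k <= v) -> u <= v.
Proof.
move=> uv; have [_ _ /(_ u)[[S Scl ueq] _] _] := eP.
rewrite {1}ueq; apply: (bigsup_le Lc) => k Sk.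
by apply: uv; [exact: Scl|rewrite ueq; exact: (bigsup_ub Lc)].
Qed.

Lemma closed_leI k a b : closed_elt e k -> k <= e a -> k <= e b ->
  k <= e (a `&` b).
Proof.
move=> [F Fd ->] /(directed_inf_le Fd)[f Ff fa] /(directed_inf_le Fd)[g Fg gb].
have [_ /(_ _ _ Ff Fg)[h [Fh hf hg]]] := Fd.
apply: (@le_trans _ _ (e h)); first by apply: (biginf_lb Lc); exists h.
by rewrite e_mono lexI (le_trans hf fa) (le_trans hg gb).
Qed.

(** The map [e] is only assumed to be an order embedding; that it preserves binary meets comes from
    denseness and compactness. *)
Lemma emb_meet_le a b : e a `&` e b <= e (a `&` b).
Proof.
by apply: le_closed => k kc; rewrite lexI => /andP[]; exact: closed_leI.
Qed.

Lemma emb_bot_le_open o : open_elt e o -> e \bot <= o.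
Proof.
move=> [I [[i Ii] _] ->]; apply: (@le_trans _ _ (e i)).
  by rewrite e_mono le0x.
by apply: (bigsup_ub Lc); exists i.
Qed.

Lemma emb_join_le_open o a b : open_elt e o -> e a <= o -> e b <= o ->
  e (a `|` b) <= o.
Proof.
move=> [I Id ->] /(le_directed_sup Id)[i Ii ai] /(le_directed_sup Id)[j Ij bj].
have [_ /(_ _ _ Ii Ij)[h [Ih ih jh]]] := Id.
apply: (@le_trans _ _ (e h)); last by apply: (bigsup_ub Lc); exists h.
by rewrite e_mono leUx (le_trans ai ih) (le_trans bj jh).
Qed.

Lemma le_rhd (N : set (A * A)) a b : N (a, b) -> e b <= rhd e N a.
Proof. by move=> Nab; apply: (bigsup_ub Lc); exists b. Qed.

Lemma rhd_le (N : set (A * A)) a u :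
  (forall b, N (a, b) -> e b <= u) -> rhd e N a <= u.
Proof. by move=> Nu; apply: (bigsup_le Lc) => _ [b Nab <-]; exact: Nu. Qed.

Lemma Diamond_le (R : set (A * A)) a b : R (a, b) -> Diamond e R a <= e b.
Proof. by move=> Rab; apply: (biginf_lb Lc); exists b. Qed.

Lemma regular_antitone (g : A -> L) : regular g -> antitone g.
Proof. by move=> gr a b ab; rewrite -(join_r ab) gr leIl. Qed.

(** * From rules for [N] to properties of [rhd e N] *)

Section Rules.
Variables (i : nat) (R N : set (A * A)).
Hypothesis NR : noncontact_rules i R N.

Let N_bot a : N (a, \bot).
Proof. by have [[top_bot anti _ _] _] := NR; exact: anti top_bot (lex1 a). Qed.

Let N_anti a b c : a <= b -> N (b, c) -> N (a, c).
Proof. by move=> ab Nbc; have [[_ anti _ _] _] := NR; exact: anti ab. Qed.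

Let N_down a b c : b <= c -> N (a, c) -> N (a, b).
Proof. by move=> bc Nac; have [[_ _ down _] _] := NR; exact: down bc. Qed.

Lemma noncontact_up_directed a : up_directed [set b | N (a, b)].
Proof.
split; first by exists \bot.
move=> x y Nx Ny; exists (x `|` y); split; rewrite ?leUl ?leUr //.
by have [[_ _ _ join] _] := NR; exact: join.
Qed.

Lemma rhd_open a : open_elt e (rhd e N a).
Proof. by exists [set b | N (a, b)] => //; exact: noncontact_up_directed. Qed.

Lemma rhd_antitone : antitone (rhd e N).
Proof. by move=> a b ab; apply: rhd_le => c Nbc; exact/le_rhd/(N_anti ab). Qed.

Lemma rhd_regular : i \in [:: 2; 4]%N -> regular (rhd e N).
Proof.
move=> i24 a b; apply/eqP; rewrite eq_le; apply/andP; split.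
  by rewrite lexI !rhd_antitone ?leUl ?leUr.
(* A closed [k] below both joins lies below single members [e x] and [e y]; then [x]&[y] is related
   to both [a] and [b], hence to their join. *)
apply: le_closed => k kc; rewrite lexI => /andP[].
move=> /(closed_le_directed_sup (noncontact_up_directed a) kc)[x Nax kx].
move=> /(closed_le_directed_sup (noncontact_up_directed b) kc)[y Nby ky].
apply: le_trans (closed_leI kc kx ky) _; apply: le_rhd.
have [_ [/(_ i24) Nor _]] := NR.
by apply: Nor; [exact: N_down (leIl _ _) Nax|exact: N_down (leIr _ _) Nby].
Qed.

Lemma meet_Diamond_le a c : prec_rules i R ->
  e a `&` Diamond e R a <= e c -> exists2 b, R (a, b) & a `&` b <= c.
Proof.
move=> [[R_top R_si R_wo R_and] _] ac.
pose F := [set a `&` b | b in [set b | R (a, b)]].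
have Fd : down_directed F.
  split; first by exists (a `&` \top), \top => //; apply: R_si R_top; exact: lex1.
  move=> _ _ [x Rax <-] [y Ray <-]; exists (a `&` (x `&` y)); split.
  - by exists (x `&` y) => //; exact: R_and.
  - by rewrite leI2 ?leIl.
  - by rewrite leI2 ?leIr.
have [|_ [b Rab <-] abc] := directed_inf_le (a := c) Fd; last by exists b.
apply: le_trans ac; rewrite lexI; apply/andP; split.
  (* The pair [(a, \top)] is in [R], so the member [a]&[\top] of [F] bounds the meet by [e a]. *)
  apply: (@le_trans _ _ (e (a `&` \top))); last by rewrite e_mono leIl.
  apply: (biginf_lb Lc); exists (a `&` \top) => //; exists \top => //.
  by apply: R_si R_top; exact: lex1.
apply: (biginf_ge Lc) => _ [b Rab <-].
apply: (@le_trans _ _ (e (a `&` b))); last by rewrite e_mono leIr.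
by apply: (biginf_lb Lc); exists (a `&` b) => //; exists b.
Qed.

(** Any [c] above the closed element is above some [a]&[b] with [R (a, b)]; so [N (c, x)] gives
    [N (a]&[b, x)], and the cut rule gives [N (a, x)]. *)
Lemma rhd_ext_closed_le : i \in [:: 3; 4]%N -> prec_rules i R ->
  forall a, ext_closed e (rhd e N) (e a `&` Diamond e R a) <= rhd e N a.
Proof.
move=> i34 RR a; apply: (bigsup_le Lc) => _ [c ac <-].
have [b Rab abc] := meet_Diamond_le RR ac.
apply: rhd_le => x Ncx; apply: le_rhd.
have [_ [_ /(_ i34) Nct]] := NR.
by apply: Nct Rab _; exact: N_anti abc Ncx.
Qed.

End Rules.

Lemma noncontact_rules_of_map i (R : set (A * A)) (g : A -> L) :
  (forall a, open_elt e (g a)) -> antitone g ->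
  (i \in [:: 2; 4]%N -> regular g) ->
  (i \in [:: 3; 4]%N ->
    forall a, ext_closed e g (e a `&` Diamond e R a) <= g a) ->
  noncontact_rules i R [set p | e p.2 <= g p.1].
Proof.
move=> gopen ganti greg gct; split=> /=.
  split=> [|a b c bc ab|a b c ac bc|a b c].
  - exact: emb_bot_le_open.
  - exact: le_trans (ganti _ _ ab).
  - by apply: le_trans ac; rewrite e_mono.
  - exact: emb_join_le_open.
split=> [/greg {}greg a b c ac bc|/gct {}gct a b c Rab abc].
  by rewrite greg lexI ac.
(* Since [e a]&[Diamond e R a <= e (a]&[b)], the value [g (a]&[b)] is one of the joinands of
   [ext_closed]. *)
apply: le_trans abc (le_trans _ (gct a)); apply: (bigsup_ub Lc).
exists (a `&` b) => //=; apply: le_trans (emb_meet_le a b).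
by rewrite leI2 // Diamond_le.
Qed.

End CanonicalExtension.

(** * The closures obey their own rules *)

Lemma prec_closure_rules {d} {A : tbLatticeType d} i (prec : set (A * A)) :
  prec_rules i (prec_closure i prec).
Proof.
split; [split|split].
- by move=> S [[[]]].
- by move=> a b x ab Rbx S SP; have [[[_ si _ _] _] _] := SP; exact: si ab (Rbx S SP).
- by move=> b x y Rbx xy S SP; have [[[_ _ wo _] _] _] := SP; exact: wo (Rbx S SP) xy.
- move=> a x y Rax Ray S SP; have [[[_ _ _ meet] _] _] := SP.
  exact: meet (Rax S SP) (Ray S SP).
- move=> i24 a b x Rax Rbx S SP; have [[_ [/(_ i24) join _]] _] := SP.
  exact: join (Rax S SP) (Rbx S SP).
- move=> i34 a b c Rab Rabc S SP; have [[_ [_ /(_ i34) ct]] _] := SP.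
  exact: ct (Rab S SP) (Rabc S SP).
Qed.

(** Each rule is a Horn clause in [N], hence stable under intersection; in the cut rule the relation
    [prec_closure i prec] stays fixed. *)
Lemma noncontact_closure_rules {d} {A : tbLatticeType d} i
    (prec contact : set (A * A)) :
  noncontact_rules i (prec_closure i prec) (noncontact_closure i prec contact).
Proof.
split; [split|split].
- by move=> S [[[]]].
- move=> a b c Nbc ab S SP; have [[[_ anti _ _] _] _] := SP.
  exact: anti (Nbc S SP) ab.
- move=> a b c Nac bc S SP; have [[[_ _ down _] _] _] := SP.
  exact: down (Nac S SP) bc.
- move=> a b c Nab Nac S SP; have [[[_ _ _ join] _] _] := SP.
  exact: join (Nab S SP) (Nac S SP).
- move=> i24 a b c Nac Nbc S SP; have [[_ [/(_ i24) join _]] _] := SP.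
  exact: join (Nac S SP) (Nbc S SP).
- move=> i34 a b c Rab Nabc S SP; have [[_ [_ /(_ i34) ct]] _] := SP.
  exact: ct Rab (Nabc S SP).
Qed.

Lemma rhd_noncontact_closure_dominates {d d'} {A : tbLatticeType d}
    {L : tbLatticeType d'} {e : A -> L} i (prec contact : set (A * A)) :
  canonical_extension e ->
  dominates (rhd e (noncontact_closure i prec contact))
            (rhd e (~` contact)%classic).
Proof.
move=> eP a; apply: (rhd_le eP) => b Nab; apply: (le_rhd eP).
exact: sub_gen_smallest Nab.
Qed.

Lemma rhd_noncontact_closure_min {d d'} {A : tbLatticeType d}
    {L : tbLatticeType d'} {e : A -> L} i (prec contact : set (A * A))
    (g : A -> L) :
  canonical_extension e -> (forall a, open_elt e (g a)) -> antitone g ->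
  dominates g (rhd e (~` contact)%classic) ->
  (i \in [:: 2; 4]%N -> regular g) ->
  (i \in [:: 3; 4]%N -> forall a,
    ext_closed e g (e a `&` Diamond e (prec_closure i prec) a) <= g a) ->
  forall a, rhd e (noncontact_closure i prec contact) a <= g a.
Proof.
move=> eP gopen ganti gdom greg gct a; apply: (rhd_le eP) => b Nab.
(* [Nab] holds in every relation that obeys the rules and contains the complement of [contact], in
   particular in the one encoding [g]. *)
apply: (Nab [set p | e p.2 <= g p.1]); split.
  exact: noncontact_rules_of_map.
by move=> [x y] Nxy /=; exact: le_trans (le_rhd eP Nxy) (gdom x).
Qed.

Theorem proposition6p3 (d d' : Order.disp_t)
    (A : tbLatticeType d) (Adelta : tbLatticeType d') (e : A -> Adelta)
    (prec contact : set (A * A))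
    (eP : canonical_extension e)
    (H_defined : defined_proto_sp_algebra prec contact) :
  let rhd0 := rhd e (~` contact)%classic in
  let Diamond_ i := Diamond e (prec_closure i prec) in
  let rhd_ i := rhd e (noncontact_closure i prec contact) in
  [/\ smallest_map e (fun g => antitone g /\ dominates g rhd0) (rhd_ 1%N),
      smallest_map e (fun g => regular g /\ dominates g rhd0) (rhd_ 2%N),
      smallest_map e (fun g => [/\ antitone g, dominates g rhd0 &
          forall a, ext_closed e g (e a `&` Diamond_ 3%N a) <= g a])
        (rhd_ 3%N) &
      smallest_map e (fun g => [/\ regular g, dominates g rhd0 &
          forall a, ext_closed e g (e a `&` Diamond_ 4%N a) <= g a])
        (rhd_ 4%N)].
Proof.
move=> rhd0 Diamond_ rhd_.
have RR i := prec_closure_rules i prec.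
have NR i := noncontact_closure_rules i prec contact.
have open_rhd i a : open_elt e (rhd_ i a) by exact: rhd_open (NR i) a.
have anti_rhd i : antitone (rhd_ i) by move=> a b; exact: (rhd_antitone eP (NR i)).
have dom_rhd i : dominates (rhd_ i) rhd0.
  exact: rhd_noncontact_closure_dominates.
split; split=> //.
(* Conditions guarded by a list that omits the current index are vacuous by computation. *)
- by move=> g gopen [ganti gdom]; exact: rhd_noncontact_closure_min.
- by split=> //; exact: (rhd_regular eP (NR 2%N)).
- move=> g gopen [greg gdom]; apply: rhd_noncontact_closure_min => //.
  exact: regular_antitone.
- by split=> //; exact: (rhd_ext_closed_le eP (NR 3%N)).
- by move=> g gopen [ganti gdom gct]; exact: rhd_noncontact_closure_min.
- split=> //; first exact: (rhd_regular eP (NR 4%N)).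
  exact: (rhd_ext_closed_le eP (NR 4%N)).
- move=> g gopen [greg gdom gct]; apply: rhd_noncontact_closure_min => //.
  exact: regular_antitone.
Qed.
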